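(* Assume that the scheduling space $\mathcal{P}$ is a (non-empty) open subset of $\mathbb{R}^D$, let $\mathcal{U}=\mathcal{P}\times\mathbb{R}^m$, and let $f:\mathcal{U}^+\to\mathbb{R}$ be an input-output map which admits a GCR. Then $f$ has a realization by an ALPV if and only if $f$ satisfies some affine polynomial equation (of some order $n$).
   Context: Fix positive integers $D,m$, and let the output dimension be $r=1$; put $Q=\{1,\dots,D\}$. For a set $X$, $X^+$ denotes the set of finite non-empty sequences of elements of $X$, and $|v|$ the length of $v$. $\mathbb{N}$ contains $0$. ALPV. For $\mathcal{P}\subseteq\mathbb{R}^D$, a discrete-time affine LPV system (ALPV) with scheduling space $\mathcal{P}$ consists of $n_x\in\mathbb{N}$ and matrices $A_q\in\mathbb{R}^{n_x\times n_x}$, $B_q\in\mathbb{R}^{n_x\times m}$, $C_q\in\mathbb{R}^{1\times n_x}$, $q\in Q$, and has dynamics $$x(t+1)=\sum_{q=1}^D (A_qx(t)+B_qu(t))p_q(t),\qquad y(t)=\sum_{q=1}^D C_qx(t)p_q(t),$$ with $p(t)=(p_1(t),\dots,p_D(t))\in\mathcal{P}$, $u(t)\in\mathbb{R}^m$. It is a realization of $f$ if for every $w=(p(0),u(0))\cdots(p(t),u(t))\in\mathcal{U}^+$, $f(w)$ equals the output $y(t)$ at time $t$ when $x(0)=0$ and the scheduling values and inputs in $w$ are applied. GCR. $f$ has a generalized convolution representation (GCR) if there is a map $S^f:\{v\in Q^+:|v|>1\}\to\mathbb{R}^{1\times m}$ such that for every $w=(p(0),u(0))\cdots(p(t),u(t))\in\mathcal{U}^+$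 $$f(w)=\sum_{k=0}^{t-1}\Big\{\sum_{v\in Q^+,|v|=t-k+1}S^f(v)\,\underline{p}_{k:t}^{v}\Big\}u(k),$$ where for $v=q_0\cdots q_{t-k}$, $\underline{p}_{k:t}^{v}=p_{q_0}(k)p_{q_1}(k+1)\cdots p_{q_{t-k}}(t)$. Affine polynomial equation. An affine polynomial equation of order $n$ is a (real) polynomial in the variables $\mathbf{P}=\{P_{i,j}\}_{i=0,\dots,n,\,j\in Q}$, $\mathbf{Y}=\{Y_i\}_{i=0}^n$, $\mathbf{U}=\{U_{i,j}\}_{i=1,\dots,n,\,j=1,\dots,m}$ of the form $$E(\mathbf{P},\mathbf{Y},\mathbf{U})=\sum_{j=0}^n Q_j(\mathbf{P})Y_j+\sum_{i=1}^n\sum_{j=1}^m L_{i,j}(\mathbf{P})U_{i,j},$$ where $Q_j$ and $L_{i,j}$ are polynomials in $\mathbf{P}$ and $Q_0\ne0$ as a polynomial. The map $f$ satisfies $E$ if for each $w=(p(0),u(0))\cdots(p(t),u(t))\in\mathcal{U}^+$ with $t>n$, the value of $E$ is $0$ under the substitution $P_{i,j}=p_j(t-i)$, $Y_i=f((p(0),u(0))\cdots(p(t-i),u(t-i)))$ for $i=0,\dots,n$, $j\in Q$, and $U_{i,l}=u_l(t-i)$ for $i=1,\dots,n$, $l=1,\dots,m$. *)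

(* Defs.v *)
From HB Require Import structures.
From mathcomp Require Import all_boot all_order all_algebra.
From mathcomp Require Import all_classical all_reals all_analysis.
(* The notations of mpoly clash with those of mathcomp-analysis. *)
From mathcomp Require Import -(notations) mpoly.

Set Implicit Arguments.
Unset Strict Implicit.
Unset Printing Implicit Defensive.

Import Order.TTheory GRing.Theory Num.Theory.
Import numFieldNormedType.Exports.

Local Open Scope classical_set_scope.
Local Open Scope ring_scope.

Section Words.
Variables (R : realType) (D m : nat) (P : set 'cV[R]_D).

Definition sample : Type := (set_type P * 'cV[R]_m)%type.

(* A map from the non-empty words over [sample] to R; the component [f t] is
   its restriction to the words (p(0),u(0))...(p(t),u(t)) of length t + 1. *)
Definition iomap : Type := forall t : nat, t.+1.-tuple sample -> R.

(* The next three are meaningful for times at most t. *)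
Definition sched t (w : t.+1.-tuple sample) (s : nat) : 'cV[R]_D :=
  \val (tnth w (inord s)).1.

Definition input t (w : t.+1.-tuple sample) (s : nat) : 'cV[R]_m :=
  (tnth w (inord s)).2.

(* (p(0),u(0))...(p(s),u(s)) *)
Definition prefix_word t (w : t.+1.-tuple sample) (s : nat) :
    s.+1.-tuple sample :=
  [tuple tnth w (inord k) | k < s.+1].

End Words.

Section ALPV.
Variables (R : realType) (D m : nat).

Record alpv := ALPV {
  nx : nat;
  matA : 'I_D -> 'M[R]_nx;
  matB : 'I_D -> 'M[R]_(nx, m);
  matC : 'I_D -> 'rV[R]_nx }.

Fixpoint alpv_state (Sg : alpv) (p : nat -> 'cV[R]_D) (u : nat -> 'cV[R]_m)
    (t : nat) : 'cV[R]_(nx Sg) :=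
  if t is s.+1 then
    \sum_(q < D) p s q 0 *:
      (matA Sg q *m alpv_state Sg p u s + matB Sg q *m u s)
  else 0.

Definition alpv_output (Sg : alpv) (p : nat -> 'cV[R]_D) (u : nat -> 'cV[R]_m)
    (t : nat) : R :=
  \sum_(q < D) (matC Sg q *m alpv_state Sg p u t) 0 0 * p t q 0.

Definition realizes (P : set 'cV[R]_D) (Sg : alpv) (f : iomap m P) : Prop :=
  forall t (w : t.+1.-tuple (sample m P)),
    f t w = alpv_output Sg (sched w) (input w) t.

End ALPV.

Section GCR.
Variables (R : realType) (D m : nat) (P : set 'cV[R]_D).

(* p_{q_0}(k) p_{q_1}(k+1) ... p_{q_(l-1)}(k+l-1) for v = q_0 ... q_(l-1) *)
Definition sched_monomial (p : nat -> 'cV[R]_D) (k l : nat)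
    (v : l.-tuple 'I_D) : R :=
  \prod_(i < l) p (k + i)%N (tnth v i) 0.

(* Only the values of [Sf] on words of length at least 2 are used. *)
Definition has_GCR (f : iomap m P) : Prop :=
  exists Sf : seq 'I_D -> 'rV[R]_m,
    forall t (w : t.+1.-tuple (sample m P)),
      f t w =
      \sum_(k < t)
        ((\sum_(v : (t - k).+1.-tuple 'I_D)
            sched_monomial (sched w) k v *: Sf v) *m input w k) 0 0.

End GCR.

Section AffineEquation.
Variables (R : realType) (D m n : nat).

Definition sched_index : finType := ('I_n.+1 * 'I_D)%type.

(* The variables P_{i,j}, Y_i and U_{i,j}; as the first index of U starts at 1,
   [inr (i, j)] stands for U_{i+1,j}. *)
Definition eqn_index : finType := (sched_index + 'I_n.+1 + 'I_n * 'I_m)%type.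

Definition sched_poly := mpoly #|sched_index| R.
Definition eqn_poly := mpoly #|eqn_index| R.

Definition eqn_var (x : eqn_index) : eqn_poly :=
  mpolyX R (mnm1 (enum_rank x)).

Definition embedP (q : sched_poly) : eqn_poly :=
  comp_mpoly [tuple eqn_var (inl (inl (enum_val k))) | k < #|sched_index|] q.

Definition is_affine_equation (E : eqn_poly) : Prop :=
  exists (Q : 'I_n.+1 -> sched_poly) (L : 'I_n -> 'I_m -> sched_poly),
    Q ord0 != 0 /\
    E = \sum_(j < n.+1) embedP (Q j) * eqn_var (inl (inr j)) +
        \sum_(i < n) \sum_(j < m) embedP (L i j) * eqn_var (inr (i, j)).

Definition subst_value (P : set 'cV[R]_D) (f : iomap m P) t
    (w : t.+1.-tuple (sample m P)) (x : eqn_index) : R :=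
  match x with
  | inl (inl (i, j)) => sched w (t - i) j 0
  | inl (inr i) => f (t - i)%N (prefix_word w (t - i))
  | inr (i, l) => input w (t - i.+1) l 0
  end.

Definition satisfies (P : set 'cV[R]_D) (f : iomap m P) (E : eqn_poly) : Prop :=
  forall t (w : t.+1.-tuple (sample m P)), (n < t)%N ->
    meval (fun k => subst_value f w (enum_val k)) E = 0.

End AffineEquation.

(* Main.v *)
(* From a realization to an equation: the outputs at times t-n, ..., t are
   affine in the state x(t-n), with coefficients (rows) polynomial in the
   scheduling. Among all nonzero minors of these rows take one of maximal size;
   bordering it by a later row and any column gives a vanishing determinant,
   whose expansion is a relation between the rows in which the coefficient of the
   later row is the nonzero minor. Applied to the outputs, this relation
   eliminates the state.

   From an equation to a realization: an impulse at a time that the equation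
   does not see yields, since a polynomial vanishing on an open set vanishes, a
   homogeneous equation satisfied by every row h(w) = S(vw) of the Hankel matrix
   of S. The solutions h form a shift-invariant linear space. As Q_0 is nonzero,
   a solution vanishing on the words of length at most n vanishes on the words of
   length n+1, hence, by shift-invariance, everywhere. So the space of solutions
   has finite dimension, and the shifts on it are the state matrices of a
   realization. *)
Require Import Defs.
From mathcomp Require Import all_boot all_order all_algebra.
From mathcomp Require Import all_classical all_reals all_analysis.
From mathcomp Require Import zify.
From mathcomp Require Import -(notations) mpoly.
Set Implicit Arguments.
Unset Strict Implicit.
Unset Printing Implicit Defensive.
Import Order.TTheory GRing.Theory Num.Theory.
Import numFieldNormedType.Exports.
Local Open Scope classical_set_scope.
Local Open Scope ring_scope.

(** * Nonroots of polynomials *)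

Lemma poly_neq0_nonroot (F : numDomainType) (p : {poly F}) :
  p != 0 -> exists x, p.[x] != 0.
Proof.
move=> p0; apply: contrapT => H.
have: (size p < size p)%N.
  rewrite -{1}(size_mkseq (fun i => i%:R : F) (size p)).
  apply: max_poly_roots => //.
    apply/allP => x _; apply/negPn/negP => xr; apply: H; by exists x.
  by rewrite map_inj_uniq ?iota_uniq // => i j /eqP; rewrite eqr_nat => /eqP.
by rewrite ltnn.
Qed.

Lemma poly_eq0_near0 (F : numFieldType) (p : {poly F}) (d : F) :
  0 < d -> (forall x, `|x| < d -> p.[x] = 0) -> p = 0.
Proof.
move=> d0 H; apply/eqP/negPn/negP => p0.
have: (size p < size p)%N; last by rewrite ltnn.
(* These would be too many roots: the points [d / (i + 2)] are distinct, and the shift by 2 keeps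
   them strictly within distance [d] of 0. *)
rewrite -{1}(size_mkseq (fun i => d / i.+2%:R : F) (size p)).
apply: max_poly_roots => //.
  apply/allP => x /mapP[i _ ->]; apply/eqP/H.
  by rewrite gtr0_norm ?divr_gt0 // ltr_pdivrMr // ltr_pMr // ltr1n.
rewrite map_inj_uniq ?iota_uniq // => i j /(mulfI (lt0r_neq0 d0)) /invr_inj /eqP.
by rewrite eqr_nat => /eqP[].
Qed.

(** Induction on the number of variables. Viewed as a polynomial in the last variable, [p] has a
    nonzero coefficient [c]; a nonroot of [c] specializes [p] to a nonzero univariate polynomial. *)
Lemma mpoly_neq0_nonroot (F : numDomainType) n (p : mpoly n F) :
  p != 0 -> exists v, meval v p != 0.
Proof.
elim: n p => [|n IHn] p p0.
  exists (fun=> 0); rewrite mevalE (bigD1_seq (mlead p)) ?mlead_supp ?msupp_uniq //=.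
  rewrite big_ord0 mulr1 big1 ?addr0 ?mleadc_eq0 // => i /negP[].
  by apply/eqP/mnmP => -[].
pose m0 := mlead p.
pose c := (muni p)`_(m0 ord_max).
have cN0 : c != 0.
  apply: contra_neq (p0) => cE; apply/eqP; rewrite -mleadc_eq0 -/m0; apply/eqP.
  have := congr1 (mcoeff (Multinom [tuple m0 (widen_ord (leqnSn n) i) | i < n])) cE.
  rewrite mcoeff0 /c muniE coef_sum raddf_sum /= => <-.
  rewrite (bigD1_seq m0) ?mlead_supp ?msupp_uniq //=; rewrite coefZ coefXn eqxx mulr1.
  rewrite mcoeffZ mcoeffX eqxx mulr1 big1 ?addr0 // => m mm0; rewrite coefZ coefXn.
  case: eqP => [e|]; last by rewrite mulr0 mcoeff0.
  rewrite mulr1 mcoeffZ mcoeffX; case: eqP => [e2|]; last by rewrite mulr0.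
  case/negP: mm0; apply/eqP/mnmP => i.
  case: (unliftP ord_max i) => [j ->|-> //].
  have := congr1 (fun m' : multinom n => m' j) e2; rewrite !mnmE.
  suff -> : widen_ord (leqnSn n) j = lift ord_max j by [].
  by apply/val_inj; rewrite /= /bump leqNgt ltn_ord.
have [v cv] := IHn _ cN0.
have [|x qx] := @poly_neq0_nonroot F (map_poly (meval v) (muni p)).
  apply: contraNneq cv => q0.
  by apply/eqP; rewrite /c -[LHS](coef_map (meval v)) q0 coef0.
exists (fun i => if unlift ord_max i is Some j then v j else x).
apply: contraNneq qx => px; apply/eqP; rewrite -[RHS]px.
rewrite muniE rmorph_sum horner_sum mevalE; apply: eq_bigr => m _ /=.
rewrite map_polyZ map_polyXn /= hornerZ hornerXn mevalZ mevalX.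
rewrite big_ord_recr /= unlift_none mulrA; congr (_ * _ * _).
apply: eq_bigr => i _; rewrite mnmE.
have -> : widen_ord (leqnSn n) i = lift ord_max i.
  by apply/val_inj; rewrite /= /bump leqNgt ltn_ord.
by rewrite liftK.
Qed.

(** * Polynomial functions of the scheduling *)

Section PolynomialFunctions.
Variables (R : realType) (D : nat).
Implicit Types (p : nat -> 'cV[R]_D) (g h : (nat -> 'cV[R]_D) -> R).

(* The variable P_{i,j} is evaluated at p_j(n - i): time is counted forward
   from the oldest sample occurring in an equation of order n. *)
Definition sched_point n p (k : 'I_#|sched_index D n|) : R :=
  p (n - (enum_val k).1)%N (enum_val k).2 0.

Definition polyfun n g : Prop :=
  exists q : sched_poly R D n, forall p, g p = meval (sched_point p) q.

Lemma eq_polyfun n g h : polyfun n g -> g =1 h -> polyfun n h.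
Proof. by move=> [q qE] gh; exists q => p; rewrite -gh. Qed.

Lemma polyfun_cst n c : polyfun n (fun=> c).
Proof. by exists (mpolyC _ c) => p; rewrite mevalC. Qed.

Lemma polyfun_coord n s j : (s <= n)%N -> polyfun n (fun p => p s j 0).
Proof.
move=> sn; have ns : (n - s < n.+1)%N by rewrite ltnS leq_subr.
exists (mpolyX R (mnm1 (enum_rank (Ordinal ns, j)))) => p.
by rewrite mevalXU /sched_point enum_rankK /= subKn.
Qed.

Lemma polyfunD n g h :
  polyfun n g -> polyfun n h -> polyfun n (fun p => g p + h p).
Proof. by move=> [q qE] [r rE]; exists (q + r) => p; rewrite mevalD qE rE. Qed.

Lemma polyfunM n g h :
  polyfun n g -> polyfun n h -> polyfun n (fun p => g p * h p).
Proof. by move=> [q qE] [r rE]; exists (q * r) => p; rewrite mevalM qE rE. Qed.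

Lemma polyfunN n g : polyfun n g -> polyfun n (fun p => - g p).
Proof. by move=> [q qE]; exists (- q) => p; rewrite mevalN qE. Qed.

Lemma polyfun_sum n (I : Type) (r : seq I) (S : pred I) (F : I -> _ -> R) :
  (forall i, S i -> polyfun n (F i)) ->
  polyfun n (fun p => \sum_(i <- r | S i) F i p).
Proof.
move=> FP; elim: r => [|i r IHr].
  by apply: (eq_polyfun (polyfun_cst n 0)) => p; rewrite big_nil.
have [Si|nSi] := boolP (S i).
  by apply: (eq_polyfun (polyfunD (FP i Si) IHr)) => p; rewrite big_cons Si.
by apply: (eq_polyfun IHr) => p; rewrite big_cons (negPf nSi).
Qed.

Lemma polyfun_prod n (I : Type) (r : seq I) (F : I -> _ -> R) :
  (forall i, polyfun n (F i)) -> polyfun n (fun p => \prod_(i <- r) F i p).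
Proof.
move=> FP; elim: r => [|i r IHr].
  by apply: (eq_polyfun (polyfun_cst n 1)) => p; rewrite big_nil.
by apply: (eq_polyfun (polyfunM (FP i) IHr)) => p; rewrite big_cons.
Qed.

Lemma polyfun_det n k (F : 'I_k -> 'I_k -> _ -> R) :
  (forall i j, polyfun n (F i j)) ->
  polyfun n (fun p => \det (\matrix_(i, j) F i j p)).
Proof.
move=> FP; apply: polyfun_sum => s _; apply: polyfunM.
  exact: polyfun_cst.
apply: polyfun_prod => i; apply: (eq_polyfun (FP i _)) => p.
by rewrite mxE.
Qed.

Lemma polyfun_meval n k (q : mpoly k R) (v : 'I_k -> _ -> R) :
  (forall i, polyfun n (v i)) -> polyfun n (fun p => meval (v^~ p) q).
Proof.
move=> vP.
apply: (@eq_polyfun _ (fun p => \sum_(m <- msupp q)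
          mcoeff m q * \prod_i \prod_(j < m i) v i p)) => [|p].
  apply: polyfun_sum => m _; apply: polyfunM; first exact: polyfun_cst.
  by apply: polyfun_prod => i; apply: polyfun_prod.
rewrite mevalE; apply: eq_bigr => m _; congr (_ * _).
by apply: eq_bigr => i _; rewrite prodr_const card_ord.
Qed.

Lemma polyfun_local n g p p' :
  polyfun n g -> (forall s, (s <= n)%N -> p s = p' s) -> g p = g p'.
Proof.
move=> [q qE] pp'; rewrite !qE; apply: meval_eq => k.
by rewrite /sched_point pp' // leq_subr.
Qed.

(** Restriction to a line reduces questions of vanishing to one variable. *)
Lemma polyfun_line n g p p' : polyfun n g ->
  exists q : {poly R}, forall x, g (fun s => p s + x *: (p' s - p s)) = q.[x].
Proof.
move=> [q qE].
pose l (k : 'I_#|sched_index D n|) :=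
  (sched_point p k)%:P + 'X * (sched_point p' k - sched_point p k)%:P.
exists (\sum_(m <- msupp q) (mcoeff m q)%:P *
          \prod_i l i ^+ m i).
move=> x; rewrite qE mevalE horner_sum; apply: eq_bigr => m _.
rewrite hornerM hornerC horner_prod; congr (_ * _); apply: eq_bigr => k _.
by rewrite horner_exp !hornerE /sched_point !mxE.
Qed.

(** On the line from [p0] to [p] the restriction of [g] is nonzero at parameter 0, so that of [h] is
    the zero polynomial; its value at 1 is [h p]. *)
Lemma polyfun_mul_eq0 n g h p0 :
  polyfun n g -> polyfun n h -> g p0 != 0 ->
  (forall p, g p * h p = 0) -> forall p, h p = 0.
Proof.
move=> gP hP gp0 gh0 p.
have [q qE] := polyfun_line p0 p gP; have [r rE] := polyfun_line p0 p hP.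
have q0 : q != 0.
  apply: contraNneq gp0 => q0; have := qE 0; rewrite q0 horner0 => <-.
  by apply/eqP; congr g; apply/funext => s; rewrite scale0r addr0.
have/eqP : q * r = 0.
  apply: (@poly_eq0_near0 _ _ 1) => // x _.
  by rewrite hornerM -qE -rE gh0.
rewrite mulf_eq0 (negPf q0) /= => /eqP r0; have := rE 1; rewrite r0 horner0 => <-.
by congr h; apply/funext => s; rewrite scale1r addrC subrK.
Qed.

(** A short initial piece of a line issuing from a constant sequence in [P] stays in [P], so the
    restriction of [g] to the line vanishes near 0, hence everywhere. *)
Lemma polyfun_eq0_open n g (P : set 'cV[R]_D) :
  open P -> P !=set0 -> polyfun n g ->
  (forall p, (forall s, P (p s)) -> g p = 0) -> forall p, g p = 0.
Proof.
move=> oP [a Pa] gP g0 p.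
(* Times after [n] do not affect [g]; with the value [a] there, only finitely many distances to [a]
   have to be bounded. *)
pose p' s := if (s <= n)%N then p s else a.
rewrite (@polyfun_local n _ _ p') // => [|s sn]; last by rewrite /p' sn.
have [q qE] := polyfun_line (fun=> a) p' gP.
have /nbhs_ballP[e /= e0 eP] := open_nbhs_nbhs (conj oP Pa).
(* [M] bounds every coordinate of [p' s - a], and the summand 1 makes it positive. *)
pose M := 1 + \sum_(s < n.+1) \sum_j `|p' s j 0 - a j 0|.
have M0 : 0 < M.
  by rewrite ltr_wpDr // sumr_ge0 // => s _; rewrite sumr_ge0.
have q0 : q = 0.
  apply: (@poly_eq0_near0 _ _ (e / M)) => [|x xd]; first by rewrite divr_gt0.
  rewrite -qE; apply: g0 => s.
  have [sn|sn] := leqP s n; last first.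
    by rewrite /p' leqNgt sn subrr scaler0 addr0.
  apply: eP; split=> // i j; rewrite ord1 /ball /= !mxE opprD addNKr normrN normrM.
  rewrite (le_lt_trans _ (_ : `|x| * M < e)) -?ltr_pdivlMr // ler_wpM2l //.
  pose s' := Ordinal (sn : (s < n.+1)%N).
  rewrite ler_wpDl // (bigD1 s') //= (bigD1 i) //= -addrA lerDl.
  by rewrite addr_ge0 // !sumr_ge0 // => k _; rewrite sumr_ge0.
have := qE 1; rewrite q0 horner0 => <-.
by congr g; apply/funext => s; rewrite scale1r addrC subrK.
Qed.

End PolynomialFunctions.

(** * Sums over words weighted by scheduling monomials *)

Section WordSums.
Variables (R : realType) (D : nat).
Implicit Types (p : nat -> 'cV[R]_D) (F : seq 'I_D -> R).

Definition word_sum p (k l : nat) F : R :=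
  \sum_(v : l.-tuple 'I_D) sched_monomial p k v * F v.

Lemma word_sum0 p k F : word_sum p k 0 F = F [::].
Proof.
rewrite /word_sum (bigD1 [tuple]) //= /sched_monomial big_ord0 mul1r big1 ?addr0 //.
by move=> v /eqP[]; exact: tuple0.
Qed.

Lemma word_sum_rcons p k l F :
  word_sum p k l.+1 F =
  \sum_q p (k + l)%N q 0 * word_sum p k l (fun v => F (rcons v q)).
Proof.
pose c (qv : 'I_D * l.-tuple 'I_D) : l.+1.-tuple 'I_D :=
  [tuple of rcons qv.2 qv.1].
have c_bij : bijective c.
  apply: inj_card_bij => [[q v] [q' v'] /(congr1 val)/= /rcons_inj[vv' ->]|].
    by congr (_, _); apply: val_inj.
  by rewrite card_prod !card_tuple card_ord expnS.
rewrite /word_sum (reindex c) /=; last exact: onW_bij.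
under [RHS]eq_bigr do rewrite big_distrr /=.
rewrite pair_bigA /=; apply: eq_bigr => -[q v] _ /=; rewrite mulrA; congr (_ * _).
rewrite /sched_monomial big_ord_recr /= mulrC; congr (_ * _).
  by congr (p _ _ _); rewrite (tnth_nth q) /= nth_rcons size_tuple ltnn eqxx.
apply: eq_bigr => i _; congr (p _ _ _).
by rewrite !(tnth_nth q) /= nth_rcons size_tuple ltn_ord.
Qed.

Lemma eq_word_sum p p' k l F F' :
  (forall i, (i < l)%N -> p (k + i)%N = p' (k + i)%N) -> F =1 F' ->
  word_sum p k l F = word_sum p' k l F'.
Proof.
move=> pp' FF'; apply: eq_bigr => v _; rewrite FF'; congr (_ * _).
by apply: eq_bigr => i _; rewrite pp'.
Qed.

Lemma eq_word_sumr p k l F F' :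
  F =1 F' -> word_sum p k l F = word_sum p k l F'.
Proof. exact: eq_word_sum. Qed.

Lemma word_sum_eq0 p k l F :
  (forall v, size v = l -> F v = 0) -> word_sum p k l F = 0.
Proof.
by move=> F0; rewrite /word_sum big1 // => v _; rewrite F0 ?mulr0 ?size_tuple.
Qed.

Lemma word_sum_linear (I : finType) p k l (c : I -> R) (F : I -> seq 'I_D -> R) :
  word_sum p k l (fun v => \sum_i c i * F i v) =
  \sum_i c i * word_sum p k l (F i).
Proof.
rewrite /word_sum; under eq_bigr do rewrite big_distrr /=.
rewrite exchange_big /=; apply: eq_bigr => i _; rewrite big_distrr /=.
by apply: eq_bigr => v _; rewrite mulrCA.
Qed.

Lemma word_sum_cat p k l s F :
  word_sum p k (l + s) F =
  word_sum p k l (fun v => word_sum p (k + l) s (fun w => F (v ++ w))).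
Proof.
elim: s F => [|s IHs] F.
  rewrite addn0; apply: eq_word_sum => // v.
  by rewrite word_sum0 cats0.
rewrite addnS word_sum_rcons; under eq_bigr do rewrite IHs.
rewrite -word_sum_linear; apply: eq_word_sum => // v; rewrite word_sum_rcons -addnA.
apply: eq_bigr => q _; congr (_ * _); apply: eq_word_sum => // w.
by rewrite rcons_cat.
Qed.

(** Unit vectors as scheduling values spell a word: its monomial is 1, and those of the other words
    of the same length are 0. *)
Lemma word_sum_delta p k (q0 : 'I_D) (v : seq 'I_D) F :
  (forall i, (i < size v)%N -> p (k + i)%N = delta_mx (nth q0 v i) 0) ->
  word_sum p k (size v) F = F v.
Proof.
elim/last_ind: v F => [|v q IHv] F pv; first by rewrite word_sum0.
rewrite size_rcons word_sum_rcons (bigD1 q) //= big1 => [|q' q'q].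
  rewrite addr0 pv ?size_rcons // nth_rcons ltnn eqxx mxE !eqxx mul1r.
  rewrite IHv // => i iv; rewrite pv ?size_rcons 1?ltnW // nth_rcons.
  by case: ltnP iv.
by rewrite pv ?size_rcons // nth_rcons ltnn eqxx mxE (negPf q'q) mul0r.
Qed.

Lemma polyfun_word_sum n k l F :
  (k + l <= n.+1)%N -> polyfun n (fun p => word_sum p k l F).
Proof.
elim: l F => [|l IHl] F kl.
  by apply: (eq_polyfun (polyfun_cst D n (F [::]))) => p; rewrite word_sum0.
apply: (eq_polyfun _ (fun p => esym (word_sum_rcons p k l F))).
apply: polyfun_sum => q _; apply: polyfunM.
  by apply: polyfun_coord; rewrite -ltnS -addnS.
by apply: IHl; rewrite (leq_trans _ kl) // leq_add2l.
Qed.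

End WordSums.

(** * Evaluation of an affine equation along a word *)

Section AffineEquationValue.
Variables (R : realType) (D m n : nat).
Variables (Q : 'I_n.+1 -> sched_poly R D n).
Variables (L : 'I_n -> 'I_m -> sched_poly R D n).

Definition affine_equation : eqn_poly R D m n :=
  \sum_(j < n.+1) embedP m (Q j) * eqn_var R (inl (inr j)) +
  \sum_(i < n) \sum_(j < m) embedP m (L i j) * eqn_var R (inr (i, j)).

Lemma meval_affine_equation (P : set 'cV[R]_D) (f : iomap m P) t
    (w : t.+1.-tuple (sample m P)) : (n < t)%N ->
  let p s := sched w (t - n + s) in
  meval (fun k => subst_value f w (enum_val k)) affine_equation =
  \sum_(j < n.+1) meval (sched_point p) (Q j) *
    f (t - j)%N (prefix_word w (t - j)) +
  \sum_(i < n) \sum_(j < m) meval (sched_point p) (L i j) *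
    input w (t - i.+1) j 0.
Proof.
move=> nt p.
have varE (x : eqn_index D m n) :
    meval (fun k => subst_value f w (enum_val k)) (eqn_var R x) =
    subst_value f w x.
  by rewrite mevalXU enum_rankK.
have embE (q : sched_poly R D n) :
    meval (fun k => subst_value f w (enum_val k)) (embedP m q) =
    meval (sched_point p) q.
  (* [P_{i,j}] is read at time [t - i], which is [n - i] when time is counted from [t - n]. *)
  rewrite comp_mpoly_meval; apply: meval_eq => k; rewrite tnth_mktuple varE.
  rewrite /sched_point; case: (enum_val k) => i j /=.
  congr (sched _ _ _ _); have := ltn_ord i; rewrite ltnS => i_n.
  by lia.
rewrite mevalD !raddf_sum /=; congr (_ + _); apply: eq_bigr => i _.
  by rewrite mevalM embE varE.
by rewrite raddf_sum /=; apply: eq_bigr => j _; rewrite mevalM embE varE.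
Qed.

End AffineEquationValue.

(** * Function spaces separated by finitely many points *)

Section FiniteSpan.

(* The rank of the matrix of values of a finite subfamily is maximal for some
   subfamily, and this subfamily spans. *)
Lemma finite_span (F : fieldType) (T : Type) (N : nat) (x : 'I_N -> T)
    (X : (T -> F) -> Prop) :
  (forall d (c : 'I_d -> F) (h : 'I_d -> T -> F),
     (forall i, X (h i)) -> X (fun v => \sum_i c i * h i v)) ->
  (forall h, X h -> (forall i, h (x i) = 0) -> forall v, h v = 0) ->
  exists d (h : 'I_d -> T -> F), (forall i, X (h i)) /\
    forall g, X g -> exists c, forall v, g v = \sum_i c i * h i v.
Proof.
move=> Xlin Xsep.
pose val_mx d (h : 'I_d -> T -> F) := \matrix_(i, j) h i (x j).
pose S (k : nat) := `[< exists d (h : 'I_d -> T -> F),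
                  (forall i, X (h i)) /\ \rank (val_mx d h) = k >].
have S0 : exists k, S k.
  exists 0%N; apply/asboolP; exists 0%N, (fun _ _ => 0); split=> [[]//|].
  by apply/eqP; rewrite -leqn0 rank_leq_row.
have SN k : S k -> (k <= N)%N.
  by move=> /asboolP[d [h [_ <-]]]; rewrite rank_leq_col.
case: (ex_maxnP S0 SN) => k /asboolP[d [h [hX hk]]] kmax.
exists d, h; split=> // g gX.
(* Adding [g] to the family cannot raise the maximal rank, so the values of [g] are a combination of
   those of the [h i]. *)
pose h' (i : 'I_(1 + d)%N) := if fintype.split i is inr j then h j else g.
have h'E : val_mx (1 + d)%N h' = col_mx (\row_j g (x j)) (val_mx d h).
  apply/matrixP => i j; rewrite !mxE /h'.
  by case: splitP => i' _; rewrite !mxE.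
have /submxP[c cE] : (\row_j g (x j) <= val_mx d h)%MS.
  have sub : (val_mx d h <= val_mx (1 + d)%N h')%MS.
    by rewrite h'E -addsmxE addsmxSr.
  have : (val_mx (1 + d)%N h' <= val_mx d h)%MS.
    rewrite -(geq_leqif (mxrank_leqif_sup sub)) hk kmax //.
    apply/asboolP; exists (1 + d)%N, h'; split=> // i.
    by rewrite /h'; case: fintype.split.
  by apply: submx_trans; rewrite h'E -addsmxE addsmxSl.
exists (fun i => c 0 i) => v.
(* The difference of [g] and this combination is itself a combination of the enlarged family, hence
   in [X]; it vanishes at all [x j]. *)
pose c' (i : 'I_(1 + d)%N) := if fintype.split i is inr j then - c 0 j else 1.
have sumE u : \sum_i c' i * h' i u = g u - \sum_i c 0 i * h i u.
  rewrite big_split_ord big_ord1 /= /c' /h'.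
  rewrite (unsplitK (inl _)) mul1r -sumrN; congr (_ + _).
  by apply: eq_bigr => i _; rewrite (unsplitK (inr _)) mulNr.
apply/eqP; rewrite -subr_eq0 -sumE; apply/eqP.
apply: (Xsep (fun v => \sum_i c' i * h' i v)) => [|j].
  by apply: Xlin => i; rewrite /h'; case: fintype.split.
rewrite sumE; have := congr1 (fun M : 'rV_N => M 0 j) cE; rewrite !mxE => ->.
by apply/eqP; rewrite subr_eq0; apply/eqP/eq_bigr => i _; rewrite mxE.
Qed.

End FiniteSpan.

(** * Solutions of the homogeneous equation *)

Section HomogeneousEquation.
Variables (R : realType) (D n : nat) (Q : 'I_n.+1 -> sched_poly R D n).
Implicit Types (p : nat -> 'cV[R]_D) (h : seq 'I_D -> R).

(** The prefix [u] builds shift-invariance into the definition, and [p] is not confined to the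
    scheduling space. Words start at the oldest time 0, so [Y_j], read at time [n - j], has words of
    length [n - j + 1]. *)
Definition homogeneous_solution h : Prop :=
  forall u p, \sum_(j < n.+1) meval (sched_point p) (Q j) *
                word_sum p 0 (n - j).+1 (fun v => h (u ++ v)) = 0.

Lemma homogeneous_solution_shift h u :
  homogeneous_solution h -> homogeneous_solution (fun v => h (u ++ v)).
Proof.
move=> hs u' p; rewrite -[RHS](hs (u ++ u') p).
apply: eq_bigr => j _; congr (_ * _); apply: eq_word_sum => // v.
by rewrite catA.
Qed.

Lemma homogeneous_solution_linear d (c : 'I_d -> R) (h : 'I_d -> _ -> R) :
  (forall i, homogeneous_solution (h i)) ->
  homogeneous_solution (fun v => \sum_i c i * h i v).
Proof.
move=> hs u p; under eq_bigr do rewrite word_sum_linear big_distrr /=.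
rewrite exchange_big big1 //= => i _.
by under eq_bigr do rewrite mulrCA; rewrite -mulr_sumr hs mulr0.
Qed.

Hypothesis Q0 : Q ord0 != 0.

(** The terms with [j > 0] involve only words of length at most [n] and vanish. What is left is a
    product with [Q_0], which can be cancelled; unit vectors then extract each value of [h]. *)
Lemma homogeneous_solution_next h :
  homogeneous_solution h ->
  (forall v, (size v <= n)%N -> h v = 0) ->
  forall v, size v = n.+1 -> h v = 0.
Proof.
move=> hs h0 v sv.
have [q q0] := mpoly_neq0_nonroot Q0.
(* The nonroot of [Q_0], rearranged as a scheduling sequence in forward time. *)
pose p0 s : 'cV[R]_D := \col_j q (enum_rank (inord (n - s)%N, j)).
have [d0 _] : exists d0 : 'I_D, True by case: v sv => [//|d0]; exists d0.
rewrite -(@word_sum_delta _ _ (fun i => delta_mx (nth d0 v i) 0) 0 d0) // sv.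
apply: (@polyfun_mul_eq0 _ _ n (fun p => meval (sched_point p) (Q ord0))
          (fun p => word_sum p 0 n.+1 h) p0).
- by exists (Q ord0).
- exact: polyfun_word_sum.
- suff -> : meval (sched_point p0) (Q ord0) = meval q (Q ord0) by [].
  apply: meval_eq => k; rewrite /sched_point mxE.
  have le_n : ((enum_val k).1 <= n)%N by rewrite -ltnS.
  by rewrite subKn // inord_val -surjective_pairing enum_valK.
- move=> p; have := hs [::] p; rewrite big_ord_recl subn0 /= big1 ?addr0 // => j _.
  rewrite word_sum_eq0 ?mulr0 // => u su; rewrite h0 // su /= /bump.
  by have := ltn_ord j; lia.
Qed.

Lemma homogeneous_solution_eq0 h :
  homogeneous_solution h ->
  (forall v, (size v <= n)%N -> h v = 0) -> forall v, h v = 0.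
Proof.
move=> hs h0 v; elim: v h hs h0 => [|q v IHv] h hs h0; first exact: h0.
apply: (IHv (fun v => h ([:: q] ++ v))).
  exact: homogeneous_solution_shift.
move=> u; rewrite leq_eqVlt => /orP[/eqP su|su]; last exact: h0.
by apply: homogeneous_solution_next => //; rewrite /= su.
Qed.

Lemma homogeneous_solution_span :
  exists d (h : 'I_d -> seq 'I_D -> R), (forall i, homogeneous_solution (h i)) /\
    forall g, homogeneous_solution g ->
      exists c, forall v, g v = \sum_i c i * h i v.
Proof.
(* The separating points are the words of length at most [n]. *)
pose W : finType := {k : 'I_n.+1 & k.-tuple 'I_D}.
pose x (i : 'I_#|W|) : seq 'I_D := tagged (enum_val i).
apply: (finite_span (x := x)) => [d c h|h hs hx]; first exact: homogeneous_solution_linear.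
apply: homogeneous_solution_eq0 => // v vn.
have := hx (enum_rank (Tagged (fun k : 'I_n.+1 => k.-tuple 'I_D)
                         (in_tuple v : (Ordinal (vn : size v < n.+1)%N).-tuple 'I_D))).
by rewrite /x enum_rankK.
Qed.

End HomogeneousEquation.

(** * The realization by shifts *)

Section Realization.
Variables (R : realType) (D m : nat) (Sf : seq 'I_D -> 'rV[R]_m).
Variables (d : nat) (h : 'I_d -> seq 'I_D -> R).
Variables (a : 'I_D -> 'I_d -> 'I_d -> R) (b : 'I_D -> 'I_m -> 'I_d -> R).
Hypothesis aE : forall q i v, h i (q :: v) = \sum_j a q i j * h j v.
Hypothesis bE : forall q l v, Sf (q :: v) 0 l = \sum_j b q l j * h j v.

(** A state [x] stands for the function [\sum_i x_i h_i] on words. [A_q] prepends the letter [q] to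
    the argument, whence the transposed indices; [B_q] adds the Hankel row of [q], and [C_q]
    evaluates at the word [q]. *)
Definition shift_alpv : alpv R D m :=
  ALPV (fun q => \matrix_(j, i) a q i j) (fun q => \matrix_(j, l) b q l j)
       (fun q => \row_i h i [:: q]).

(** The function represented by the state sends [v] to the total contribution of the past inputs
    when the past words are continued by [v]. *)
Lemma shift_alpv_state p u t v :
  \sum_i alpv_state shift_alpv p u t i 0 * h i v =
  \sum_(k < t) word_sum p k (t - k) (fun w => (Sf (w ++ v) *m u k) 0 0).
Proof.
elim: t v => [|t IHt] v.
  by rewrite big_ord0 big1 // => i _; rewrite mxE mul0r.
rewrite big_ord_recr /= subSnn word_sum_rcons addn0.
under [X in _ = _ + X]eq_bigr do rewrite word_sum0 /=.
under [X in _ = X + _]eq_bigr => k _.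
  rewrite subSn 1?ltnW // word_sum_rcons subnKC 1?ltnW //.
  under eq_bigr do under eq_word_sumr do rewrite cat_rcons.
  over.
rewrite exchange_big /= -big_split /=.
under eq_bigr do rewrite summxE mulr_suml.
rewrite exchange_big /=; apply: eq_bigr => q _.
rewrite -mulr_sumr -mulrDr -IHt.
under eq_bigr do rewrite !mxE -mulrA mulrDl.
rewrite -mulr_sumr big_split /=; congr (_ * (_ + _)).
  under eq_bigr do rewrite big_distrl /=.
  rewrite exchange_big /=; apply: eq_bigr => i _; rewrite aE mulr_sumr.
  by apply: eq_bigr => j _; rewrite mxE mulrAC mulrC mulrA mulrAC.
rewrite mxE; under eq_bigr do rewrite big_distrl /=.
rewrite exchange_big /=; apply: eq_bigr => l _; rewrite bE mulr_suml.
by apply: eq_bigr => j _; rewrite mxE mulrAC.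
Qed.

Lemma shift_alpv_output p u t :
  alpv_output shift_alpv p u t =
  \sum_(k < t) word_sum p k (t - k).+1 (fun w => (Sf w *m u k) 0 0).
Proof.
rewrite /alpv_output; under [RHS]eq_bigr => k _.
  rewrite word_sum_rcons subnKC 1?ltnW //.
  under eq_bigr do under eq_word_sumr do rewrite -cats1.
  over.
rewrite exchange_big /=; apply: eq_bigr => q _; rewrite -mulr_sumr -shift_alpv_state.
rewrite mulrC mxE; congr (_ * _); apply: eq_bigr => i _.
by rewrite mxE mulrC.
Qed.

End Realization.

(** * From an equation to a realization *)

Section EquationToRealization.
Variables (R : realType) (D m n : nat) (P : set 'cV[R]_D) (f : iomap m P).
Variables (Sf : seq 'I_D -> 'rV[R]_m).
Hypothesis fE : forall t (w : t.+1.-tuple (sample m P)),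
  f w = \sum_(k < t) word_sum (sched w) k (t - k).+1
                       (fun v => (Sf v *m input w k) 0 0).
Variables (Q : 'I_n.+1 -> sched_poly R D n).
Variables (L : 'I_n -> 'I_m -> sched_poly R D n).
Hypotheses (Q0 : Q ord0 != 0) (oP : open P) (P0 : P !=set0).
Hypothesis fQL : satisfies f (affine_equation Q L).

(* An impulse [u(0) = e_l] applied at a time that the equation does not see
   annihilates its input part. *)
Lemma impulse_response_equation l L0 p : (0 < L0)%N -> (forall s, P (p s)) ->
  \sum_(j < n.+1) meval (sched_point (fun s => p (L0 + s)%N)) (Q j) *
    word_sum p 0 (L0 + (n - j).+1) (fun v => Sf v 0 l) = 0.
Proof.
move=> L0_gt0 Pp; pose t := (L0 + n)%N.
pose w : t.+1.-tuple (sample m P) :=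
  [tuple (SigSub (mem_set (Pp i)),
          if i == 0%N :> nat then delta_mx l 0 else 0) | i < t.+1].
have nt : (n < t)%N by rewrite /t; lia.
have schedE s : (s <= t)%N -> sched w s = p s.
  by move=> st; rewrite /sched tnth_mktuple /= inordK.
have inputE s : (s <= t)%N -> input w s = if s == 0%N then delta_mx l 0 else 0.
  by move=> st; rewrite /input tnth_mktuple /= inordK.
have := @fQL t w nt; rewrite meval_affine_equation //.
rewrite [X in _ + X]big1 ?addr0 => [|i _]; last first.
  rewrite big1 // => j _; rewrite inputE ?leq_subr //.
  (* The inputs in the equation occur at times at least [L0], after the impulse. *)
  have -> : (t - i.+1 == 0)%N = false by have := ltn_ord i; rewrite /t; lia.
  by rewrite mxE mulr0.
move=> E; rewrite -[RHS]E; apply: eq_bigr => j _.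
have := ltn_ord j; rewrite ltnS => jn; congr (_ * _).
  apply: meval_eq => k; rewrite /sched_point schedE; first by congr (p _ _ _); lia.
  have := ltn_ord (enum_val k).1; lia.
rewrite fE.
have tj : (0 < t - j)%N by rewrite /t; lia.
have prefixE s : (s <= t - j)%N ->
    tnth (prefix_word w (t - j)) (inord s) = tnth w (inord s).
  by move=> st; rewrite tnth_mktuple inordK.
rewrite (bigD1 (Ordinal tj)) //= big1 => [|k k0].
  rewrite addr0 subn0; have -> : (t - j).+1 = (L0 + (n - j).+1)%N by rewrite /t; lia.
  apply: eq_word_sum => [i i_lt|v].
    rewrite /sched prefixE ?add0n; last by rewrite /t; lia.
    by rewrite -/(sched w i) schedE // /t; lia.
  rewrite /input prefixE // -/(input w 0) inputE // eqxx mxE (bigD1 l) //= big1.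
    by rewrite mxE !eqxx mulr1 addr0.
  by move=> i il; rewrite mxE (negPf il) mulr0.
apply: word_sum_eq0 => v _; rewrite /input prefixE 1?ltnW //.
rewrite -/(input w k) inputE; last by have := ltn_ord k; lia.
rewrite -val_eqE /= in k0; by rewrite (negPf k0) mulmx0 mxE.
Qed.

(** The impulse equation is polynomial in the scheduling, so it extends from [P] to all sequences.
    Its first samples may then be unit vectors spelling [v ++ u]; non-emptiness of [v] puts the
    impulse before the window of the equation. *)
Lemma hankel_row_solution v l : (0 < size v)%N ->
  homogeneous_solution Q (fun w => Sf (v ++ w) 0 l).
Proof.
move=> v0 u p.
have [d0 _] : exists d0 : 'I_D, True by case: v v0 => [//|d0]; exists d0.
pose L0 := size (v ++ u).
pose p' s : 'cV[R]_D :=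
  if (s < L0)%N then delta_mx (nth d0 (v ++ u) s) 0 else p (s - L0)%N.
have p'E s : p' (L0 + s)%N = p s by rewrite /p' ltnNge leq_addr /= addKn.
have L0_gt0 : (0 < L0)%N by rewrite /L0 size_cat ltn_addr.
pose G p := \sum_(j < n.+1) meval (sched_point (fun s => p (L0 + s)%N)) (Q j) *
    word_sum p 0 (L0 + (n - j).+1) (fun v => Sf v 0 l).
have GP : polyfun (L0 + n) G.
  apply: polyfun_sum => j _; apply: polyfunM; last first.
    by apply: polyfun_word_sum; have := ltn_ord j; lia.
  apply: (@polyfun_meval _ _ _ _ _ (fun k p =>
             sched_point (fun s => p (L0 + s)%N) k)) => k.
  by apply: polyfun_coord; rewrite leq_add2l leq_subr.
have := polyfun_eq0_open oP P0 GP (fun p => @impulse_response_equation l L0 p L0_gt0) p'.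
rewrite /G => E; rewrite -[RHS]E; apply: eq_bigr => j _; congr (_ * _).
  by apply: meval_eq => k; rewrite /sched_point p'E.
rewrite word_sum_cat (word_sum_delta (q0 := d0)) => [|i iL].
  rewrite add0n; apply: eq_bigr => x _; rewrite catA; congr (_ * _).
  by apply: eq_bigr => i _; rewrite p'E.
by rewrite add0n /p' iL.
Qed.

Lemma equation_realizable : exists Sg : alpv R D m, realizes Sg f.
Proof.
have [d [h [hs span]]] := homogeneous_solution_span Q0.
have /choice[a aE] (x : 'I_D * 'I_d) :
    exists c : 'I_d -> R, forall v, h x.2 (x.1 :: v) = \sum_j c j * h j v.
  exact: (span _ (homogeneous_solution_shift [:: x.1] (hs x.2))).
have /choice[b bE] (x : 'I_D * 'I_m) :
    exists c : 'I_d -> R, forall v, Sf (x.1 :: v) 0 x.2 = \sum_j c j * h j v.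
  exact: (span _ (@hankel_row_solution [:: x.1] x.2 isT)).
exists (shift_alpv h (fun q i => a (q, i)) (fun q l => b (q, l))) => t w.
by rewrite fE (shift_alpv_output (fun q i => aE (q, i)) (fun q l => bE (q, l))).
Qed.

End EquationToRealization.

(** * From a realization to an equation *)

Section RealizationToEquation.
Variables (R : realType) (D m : nat) (Sg : alpv R D m).
Implicit Types (z : 'cV[R]_(nx Sg)) (p : nat -> 'cV[R]_D) (u : nat -> 'cV[R]_m).

(** The recursion of [alpv_state] from an arbitrary initial state, so that it can be restarted at
    time [t - n]. *)
Fixpoint flow z p u (s : nat) : 'cV[R]_(nx Sg) :=
  if s is s'.+1 then
    \sum_(q < D) p s' q 0 *: (matA Sg q *m flow z p u s' + matB Sg q *m u s')
  else z.

Definition flow_output z p u (s : nat) : R :=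
  \sum_(q < D) (matC Sg q *m flow z p u s) 0 0 * p s q 0.

Lemma alpv_output_flow p u t s :
  alpv_output Sg p u (t + s) =
  flow_output (alpv_state Sg p u t) (fun k => p (t + k)%N) (fun k => u (t + k)%N) s.
Proof.
rewrite /alpv_output /flow_output; apply: eq_bigr => q _; congr ((_ *m _) _ _ * _).
elim: s => [|s IHs]; first by rewrite addn0.
by rewrite addnS /= IHs.
Qed.

Lemma eq_alpv_output p p' u u' t :
  (forall s, (s <= t)%N -> p s = p' s) -> (forall s, (s <= t)%N -> u s = u' s) ->
  alpv_output Sg p u t = alpv_output Sg p' u' t.
Proof.
move=> pp' uu'; rewrite /alpv_output; apply: eq_bigr => q _.
rewrite pp' //; congr ((_ *m _) _ _ * _).
have: (t <= t)%N by []; elim: {1 3 4}t => [//|s IHs] st /=.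
by rewrite IHs ?(ltnW st) // pp' ?uu' // ltnW.
Qed.

(** The coefficients are polynomial in the scheduling. Inputs are indexed backward from time [n], to
    match the variables [U] of the equation. *)
Definition affine_flow n
    (g : 'cV[R]_(nx Sg) -> (nat -> 'cV[R]_D) -> (nat -> 'cV[R]_m) -> R) : Prop :=
  exists (a : 'I_(nx Sg) -> (nat -> 'cV[R]_D) -> R)
         (b : 'I_n -> 'I_m -> (nat -> 'cV[R]_D) -> R),
    [/\ forall c, polyfun n (a c), forall i l, polyfun n (b i l) &
     forall z p u, g z p u = \sum_c a c p * z c 0 +
                     \sum_i \sum_l b i l p * u (n - i.+1)%N l 0].

Lemma affine_flow_sum n (I : finType) F g :
  (forall i, polyfun n (F i)) -> (forall i, affine_flow n (g i)) ->
  affine_flow n (fun z p u => \sum_(i : I) F i p * g i z p u).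
Proof.
move=> FP gP.
have [a aP] := choice gP; have [b bP] := choice aP.
exists (fun c p => \sum_i F i p * a i c p), (fun j l p => \sum_i F i p * b i j l p).
split=> [c|j l|z p u].
- by apply: polyfun_sum => i _; apply: polyfunM => //; case: (bP i).
- by apply: polyfun_sum => i _; apply: polyfunM => //; case: (bP i).
transitivity (\sum_i (\sum_c F i p * a i c p * z c 0 +
    \sum_j \sum_l F i p * b i j l p * u (n - j.+1)%N l 0)).
  apply: eq_bigr => i _; have [_ _ ->] := bP i; rewrite mulrDr !mulr_sumr.
  congr (_ + _); first by apply: eq_bigr => c _; rewrite mulrA.
  by apply: eq_bigr => j _; rewrite mulr_sumr; apply: eq_bigr => l _; rewrite mulrA.
rewrite big_split /= exchange_big /=; congr (_ + _).
  by apply: eq_bigr => c _; rewrite mulr_suml.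
rewrite exchange_big /=; apply: eq_bigr => j _; rewrite exchange_big /=.
by apply: eq_bigr => l _; rewrite mulr_suml.
Qed.

Lemma affine_flow_ext n g g' :
  affine_flow n g -> (forall z p u, g z p u = g' z p u) -> affine_flow n g'.
Proof.
by move=> [a [b [aP bP gE]]] gg'; exists a, b; split=> // z p u; rewrite -gg'.
Qed.

Lemma affine_flow_state n c : affine_flow n (fun z _ _ => z c 0).
Proof.
exists (fun c' _ => (c' == c)%:R), (fun _ _ _ => 0).
split=> [c'|i l|z p u]; [exact: polyfun_cst|exact: polyfun_cst|].
rewrite (bigD1 c) //= eqxx mul1r !big1 ?addr0 // => [i _|c' /negPf ->].
  by rewrite big1 // => l _; rewrite mul0r.
by rewrite mul0r.
Qed.

Lemma affine_flow_input n s l : (s < n)%N -> affine_flow n (fun _ _ u => u s l 0).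
Proof.
move=> sn; pose i0 : 'I_n := rev_ord (Ordinal sn).
exists (fun _ _ => 0), (fun i l' _ => ((i == i0) && (l' == l))%:R).
split=> [c'|i l'|z p u]; [exact: polyfun_cst|exact: polyfun_cst|].
rewrite big1 ?add0r => [|c _]; last by rewrite mul0r.
rewrite (bigD1 i0) //= (bigD1 l) //= !eqxx mul1r !big1 ?addr0.
- by congr (u _ _ _); lia.
- by move=> i /negPf ->; rewrite big1 // => l' _; rewrite mul0r.
- by move=> l' /negPf ->; rewrite mul0r.
Qed.

Lemma affine_flow_coord n s c : (s <= n)%N ->
  affine_flow n (fun z p u => flow z p u s c 0).
Proof.
elim: s c => [|s IHs] c sn; first exact: affine_flow_state.
(* One step of the recursion is a single sum over a letter and a coordinate of either the state or
   the input. *)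
pose F (x : 'I_D * ('I_(nx Sg) + 'I_m)) p :=
  p s x.1 0 *
  match x.2 with inl c' => matA Sg x.1 c c' | inr l => matB Sg x.1 c l end.
pose g (x : 'I_D * ('I_(nx Sg) + 'I_m)) z p u :=
  match x.2 with inl c' => flow z p u s c' 0 | inr l => u s l 0 end.
have := @affine_flow_sum n _ F g.
move=> /(_ _ _)/affine_flow_ext; apply.
- move=> [q x]; apply: polyfunM; last exact: polyfun_cst.
  by apply: polyfun_coord; rewrite ltnW.
- by move=> [q [c'|l]]; [apply: IHs; rewrite ltnW|apply: affine_flow_input].
move=> z p u; rewrite -(pair_bigA _ (fun q x => F (q, x) p * g (q, x) z p u)) /=.
rewrite summxE; apply: eq_bigr => q _; rewrite big_sumType /= !mxE mulrDr !mulr_sumr.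
by congr (_ + _); apply: eq_bigr => i _; rewrite /F /g /= mulrA.
Qed.

Lemma affine_flow_output n s : (s <= n)%N ->
  affine_flow n (fun z p u => flow_output z p u s).
Proof.
move=> sn.
have := @affine_flow_sum n _
  (fun (x : 'I_D * 'I_(nx Sg)) p => p s x.1 0 * matC Sg x.1 0 x.2)
  (fun x z p u => flow z p u s x.2 0).
move=> /(_ _ _)/affine_flow_ext; apply.
- by move=> x; apply: polyfunM; [exact: polyfun_coord|exact: polyfun_cst].
- by move=> x; apply: affine_flow_coord.
move=> z p u; rewrite -(pair_bigA _ (fun q c =>
  p s q 0 * matC Sg q 0 c * flow z p u s c 0)) /=.
rewrite /flow_output; apply: eq_bigr => q _; rewrite mxE mulrC mulr_sumr.
by apply: eq_bigr => c _; rewrite mulrA.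
Qed.

Definition observability_row (s : nat) p (c : 'I_(nx Sg)) : R :=
  flow_output (delta_mx c 0) p (fun=> 0) s.

(** A unit state with zero input isolates one state coefficient, which identifies it with the
    observability row. *)
Lemma flow_outputE n s : (s <= n)%N ->
  (forall c, polyfun n (fun p => observability_row s p c)) /\
  exists b : 'I_n -> 'I_m -> (nat -> 'cV[R]_D) -> R,
    (forall i l, polyfun n (b i l)) /\
    forall z p u, flow_output z p u s =
      \sum_c observability_row s p c * z c 0 +
      \sum_i \sum_l b i l p * u (n - i.+1)%N l 0.
Proof.
move=> sn; have [a [b [aP bP E]]] := affine_flow_output sn.
have rowE p c : observability_row s p c = a c p.
  rewrite /observability_row E (bigD1 c) //= !mxE !eqxx mulr1 !big1 ?addr0 //.
    by move=> i _; rewrite big1 // => l _; rewrite mxE mulr0.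
  by move=> c' /negPf cc'; rewrite mxE cc' mulr0.
split=> [c|]; first by apply: (eq_polyfun (aP c)) => p; rewrite rowE.
exists b; split=> // z p u; rewrite E; congr (_ + _).
by apply: eq_bigr => c _; rewrite rowE.
Qed.

(** Neither [s] nor [J] has to be injective or ordered: a repetition only gives a zero
    determinant. *)
Definition observability_minor k (s : 'I_k -> nat) (J : 'I_k -> 'I_(nx Sg)) p :
    R :=
  \det (\matrix_(i, j) observability_row (s i) p (J j)).

Lemma observability_minor_neq0 k (s : 'I_k -> nat) (J : 'I_k -> 'I_(nx Sg)) p :
  observability_minor s J p != 0 -> (k <= nx Sg)%N.
Proof.
rewrite /observability_minor -unitfE -unitmxE => /mxrank_unit <-.
(* Column selection is a matrix product, so the rank is at most the state dimension. *)
pose M : 'M[R]_(k, nx Sg) := \matrix_(i, c) observability_row (s i) p c.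
have -> : (\matrix_(i, j) observability_row (s i) p (J j)) =
          M *m (\matrix_(c, j) (c == J j)%:R).
  apply/matrixP => i j; rewrite !mxE (bigD1 (J j)) //= big1 => [|c /negPf cJ].
    by rewrite !mxE eqxx mulr1 addr0.
  by rewrite !mxE cJ mulr0.
exact: leq_trans (mxrankM_maxl _ _) (rank_leq_col _).
Qed.

Lemma ex_maximal_minor : exists k (s : 'I_k -> nat) (J : 'I_k -> 'I_(nx Sg)),
  (exists p, observability_minor s J p != 0) /\
  forall (s' : 'I_k.+1 -> nat) (J' : 'I_k.+1 -> 'I_(nx Sg)) p,
    observability_minor s' J' p = 0.
Proof.
pose S k := `[< exists (s : 'I_k -> nat) (J : 'I_k -> 'I_(nx Sg)) p,
                  observability_minor s J p != 0 >].
have S0 : exists k, S k.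
  exists 0%N; apply/asboolP; exists (fun=> 0%N).
  (* The empty minor equals 1, so some size is attained even when every row vanishes. *)
  exists (fun i : 'I_0 => False_rect _ (notF (ltn_ord i))), (fun=> 0).
  by rewrite /observability_minor det_mx00 oner_neq0.
have SN k : S k -> (k <= nx Sg)%N.
  by move=> /asboolP[s [J [p /observability_minor_neq0]]].
case: (ex_maxnP S0 SN) => k /asboolP[s [J [p sJ]]] kmax.
exists k, s, J; split; first by exists p.
move=> s' J' p'; apply/eqP/negPn/negP => sJ'.
have : (k < k)%N; last by rewrite ltnn.
by apply: kmax; apply/asboolP; exists s', J', p'.
Qed.

(* Bordering a maximal minor by a later output row and by an arbitrary column
   gives a zero determinant; its expansion along the new column is a relation
   between the rows whose coefficients do not depend on the column, and the
   coefficient of the later row is the maximal minor. *)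
Lemma observability_relation :
  exists n (Q : 'I_n.+1 -> (nat -> 'cV[R]_D) -> R),
    [/\ forall j, polyfun n (Q j), exists p, Q ord0 p != 0 &
     forall p c, \sum_j Q j p * observability_row (n - j) p c = 0].
Proof.
have [k [s [J [[p0 sJ] max0]]]] := ex_maximal_minor.
pose n := (\max_i s i).+1.
have s_lt i : (s i < n)%N by rewrite ltnS leq_bigmax.
(* Index 0 is the new row, at a time [n] beyond all those of the maximal minor. *)
pose r (i : 'I_k.+1) := if unlift ord0 i is Some i' then s i' else n.
have r_le i : (r i <= n)%N by rewrite /r; case: unliftP => // i' _; rewrite ltnW.
pose K (i : 'I_k.+1) p := (-1) ^+ i * observability_minor (r \o lift i) J p.
have KP i : polyfun n (K i).
  apply: polyfunM; first exact: polyfun_cst.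
  apply: (polyfun_det (F := fun a b p =>
             observability_row (r (lift i a)) p (J b))) => a b.
  by have [] := flow_outputE (r_le (lift i a)).
have K0 p c : \sum_i K i p * observability_row (r i) p c = 0.
  rewrite -[RHS](max0 r (fun j =>
    if unlift ord0 j is Some j' then J j' else c) p).
  rewrite /observability_minor (expand_det_col _ ord0); apply: eq_bigr => i _.
  rewrite !mxE unlift_none mulrC; congr (_ * _).
  rewrite /cofactor addn0 /K /observability_minor; congr (_ * \det _).
  by apply/matrixP => a b; rewrite !mxE liftK.
(* The coefficients are collected by time. At time [n] there is only the new row, so [Q_0] is the
   maximal minor. *)
exists n, (fun j p => \sum_(i | r i == (n - j)%N) K i p); split=> [j||p c].
- by apply: polyfun_sum.
- exists p0; rewrite subn0 (big_pred1 ord0) => [|i]; last first.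
    rewrite /r; case: unliftP => [i' ->|->]; last by rewrite !eqxx.
    by rewrite ltn_eqF // eq_sym; apply/negbTE/neq_lift.
  rewrite /K expr0 mul1r.
  suff -> : r \o lift ord0 = s by [].
  by apply/funext => i; rewrite /r /= liftK.
rewrite -[RHS](K0 p c) (partition_big (fun i => inord (n - r i) : 'I_n.+1) xpredT) //=.
apply: eq_bigr => j _; rewrite mulr_suml.
have jn := ltn_ord j.
have E i : (r i == (n - j)%N) = (inord (n - r i) == j).
  by rewrite -val_eqE /= inordK ?ltnS ?leq_subr //; have := r_le i; lia.
rewrite (eq_bigl _ _ E); apply: eq_bigr => i; rewrite -E => /eqP ri.
by rewrite ri.
Qed.

Lemma realization_equation (P : set 'cV[R]_D) (f : iomap m P) : realizes Sg f ->
  exists n (E : eqn_poly R D m n), is_affine_equation E /\ satisfies f E.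
Proof.
move=> fSg; have [n [q [/choice[Q QE] [p0 q0] qrow]]] := observability_relation.
have /choice[b bP] (j : 'I_n.+1) := (flow_outputE (leq_subr j n)).2.
(* Once the state is eliminated, only inputs remain; [L] cancels them. *)
have /choice[L LE] (x : 'I_n * 'I_m) :
    polyfun n (fun p => - \sum_j q j p * b j x.1 x.2 p).
  apply: polyfunN; apply: polyfun_sum => j _; apply: polyfunM.
    by exists (Q j).
  by case: (bP j).
exists n, (affine_equation Q (fun i l => L (i, l))); split.
  exists Q, (fun i l => L (i, l)); split=> //.
  by apply: contraNneq q0 => Q0; rewrite QE Q0 meval0.
move=> t w nt; rewrite meval_affine_equation //.
set p := fun s : nat => sched w (t - n + s).
pose u s := input w (t - n + s).
pose z := alpv_state Sg (sched w) (input w) (t - n).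
have fE (j : 'I_n.+1) :
    f (t - j)%N (prefix_word w (t - j)) = flow_output z p u (n - j).
  rewrite fSg -alpv_output_flow; have jn := ltn_ord j.
  have -> : (t - n + (n - j) = t - j)%N by lia.
  by apply: eq_alpv_output => s st; rewrite /sched /input tnth_mktuple inordK.
apply/eqP; rewrite addr_eq0; apply/eqP.
transitivity (\sum_j q j p * (\sum_i \sum_l b j i l p * u (n - i.+1)%N l 0)).
  apply/eqP; rewrite -subr_eq0 -sumrB; apply/eqP.
  transitivity (\sum_j \sum_c q j p * observability_row (n - j) p c * z c 0).
    apply: eq_bigr => j _; rewrite -QE fE; have [_ ->] := bP j.
    rewrite -mulrBr addrK mulr_sumr.
    by apply: eq_bigr => c _; rewrite mulrA.
  rewrite exchange_big big1 //= => c _.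
  by rewrite -mulr_suml qrow mul0r.
rewrite -sumrN; under eq_bigr do rewrite mulr_sumr.
rewrite exchange_big; apply: eq_bigr => i _ /=.
rewrite -sumrN; under eq_bigr do rewrite mulr_sumr.
rewrite exchange_big; apply: eq_bigr => l _ /=.
rewrite -LE mulNr opprK mulr_suml; have i_n := ltn_ord i.
apply: eq_bigr => j _; rewrite mulrA; congr (_ * _).
by rewrite /u; congr (input _ _ _ _); lia.
Qed.

End RealizationToEquation.

Theorem theorem6 (R : realType) (D m : nat) (P : set 'cV[R]_D)
    (f : iomap m P) :
  (0 < D)%N -> (0 < m)%N ->
  open P -> P !=set0 ->
  has_GCR f ->
  (exists Sg : alpv R D m, realizes Sg f) <->
  (exists (n : nat) (E : eqn_poly R D m n),
     is_affine_equation E /\ satisfies f E).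
Proof.
move=> _ _ oP P0 [Sf fE]; split=> [[Sg]|[n [E [[Q [L [Q0 ->]]] fQL]]]].
  exact: realization_equation.
apply: (@equation_realizable _ _ _ _ _ f Sf _ Q L) => // t w.
rewrite fE; apply: eq_bigr => k _.
rewrite mulmx_suml summxE; apply: eq_bigr => v _.
by rewrite -scalemxAl mxE.
Qed.
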